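(* For every integer $n\ge 4$, let $G_n$ be the graph constructed below. Then the Undirected Geography position $(G_n,N_n)$ has Grundy value $*n$.
   Context: Undirected Geography: a position is $(G,s)$ with $G$ a finite undirected graph and $s$ the token vertex; a move chooses a neighbor $t$ of $s$ and yields $(G_{\{s\}},t)$, where $G_S$ is $G$ with the vertices of $S$ and their incident edges deleted; normal play. Grundy value: $0$ for a terminal position, otherwise the mex of the values of the options; $*k$ denotes value $k$. Trees: $T(0)$ is a single vertex; $T(k)$ consists of a root joined to the roots of disjoint copies of $T(0),\dots,T(k-1)$. ''Attach a fresh $T(k)$ to $v$'' means add a new disjoint copy of $T(k)$ and an edge from $v$ to its root. Construction of $G_n$: vertices $N_4,\dots,N_n$ form a clique; for each $i\in\{4,\dots,n\}$ there is a vertex $R_i$ adjacent to $N_i$. Attach fresh $T(1),T(2),T(3)$ to $N_4$. For each $i\in\{5,\dots,n\}$: attach a fresh $T(3)$ to $N_i$; add vertices $M_i,P_i$ adjacent to $N_i$; add a leaf $M_i^{(0)}$ adjacent to $M_i$ and attach a fresh $T(2)$ to $M_i$; add a leaf $P_i^{(0)}$ adjacent to $P_i$ and attach a fresh $T(1)$ to $P_i$; and for each $j\in\{4,\dots,i-1\}$ add new vertices $M_{ij}^{(a)},M_{ij}^{(b)},M_{ij}^{(c)},M_{ij}^{(d)}$ with edges $M_iM_{ij}^{(a)}$, $M_{ij}^{(a)}M_{ij}^{(b)}$, $M_{ij}^{(a)}M_{ij}^{(c)}$, $M_{ij}^{(c)}M_{ij}^{(d)}$, $M_{ij}^{(d)}R_j$,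 and new vertices $P_{ij}^{(a)},\dots,P_{ij}^{(f)}$ with edges $P_iP_{ij}^{(a)}$, $P_{ij}^{(a)}P_{ij}^{(b)}$, $P_{ij}^{(a)}P_{ij}^{(c)}$, $P_{ij}^{(c)}P_{ij}^{(d)}$, $P_{ij}^{(c)}P_{ij}^{(e)}$, $P_{ij}^{(e)}P_{ij}^{(f)}$, $P_{ij}^{(f)}R_j$. *)

(* Defs.v *)
From HB Require Import structures.
From mathcomp Require Import all_boot.

Set Implicit Arguments.
Unset Strict Implicit.
Unset Printing Implicit Defensive.

Record sgraph := SGraph {
  vertex :> finType;
  edge : rel vertex;
  edge_sym : symmetric edge;
  edge_irr : irreflexive edge }.

Section Delete.
Variables (G : sgraph) (S : {set G}).

Definition del_vertex := {x : G | x \notin S}.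
Definition del_edge : rel del_vertex := fun x y => edge (val x) (val y).

Lemma del_edge_sym : symmetric del_edge.
Proof. by move=> x y; exact: edge_sym. Qed.

Lemma del_edge_irr : irreflexive del_edge.
Proof. by move=> x; exact: edge_irr. Qed.

Definition del : sgraph := SGraph del_edge_sym del_edge_irr.
End Delete.

Record position := Position { board : sgraph; token : board }.
Arguments Position : clear implicits.

(* A neighbor t of s differs from s, so it is a vertex of G_{s}. *)
Definition options (p : position) : seq position :=
  let: Position G s := p in
  [seq Position (del [set s]) t | t <- enum (del [set s]) & edge s (val t)].

Lemma mex_exists (s : seq nat) : exists k, k \notin s.
Proof.
exists (\max_(x <- s) x).+1; apply/negP => max_in.
by have := @leq_bigmax_seq _ s predT id _ max_in isT; rewrite ltnn.
Qed.

Definition mex (s : seq nat) : nat := ex_minn (mex_exists s).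

Lemma mex_nil : mex [::] = 0.
Proof. by rewrite /mex; case: ex_minnP => [[|k] // _ /(_ 0 isT)]. Qed.

(* Each move deletes one vertex, so #|board p| bounds the length of a play;
   lemma [grundyE] below shows that this amount of fuel suffices. *)
Fixpoint grundy_rec (fuel : nat) (p : position) : nat :=
  if fuel is m.+1 then mex [seq grundy_rec m q | q <- options p] else 0.

Definition grundy (p : position) : nat := grundy_rec #|board p| p.

Lemma card_del1 (G : sgraph) (s : G) : #|del [set s]| = #|G|.-1.
Proof.
by rewrite card_sig -(cardC1 s); apply: eq_card => x; rewrite !inE.
Qed.

Lemma grundyE (p : position) : grundy p = mex [seq grundy q | q <- options p].
Proof.
case: p => G s; rewrite /grundy /=.
have /prednK <- : 0 < #|G| by apply/card_gt0P; exists s.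
rewrite /= -!map_comp; congr mex.
by apply: eq_map => t /=; rewrite card_del1.
Qed.

Record rgraph := RGraph { rgraph_graph :> sgraph; root : rgraph_graph }.

(* [graft site part] is B together with, for each i : I, a new disjoint copy of
   [part i] and an edge from [site i] to the root of that copy. *)
Section Graft.
Variables (B : sgraph) (I : finType) (site : I -> B) (part : I -> rgraph).

Definition graft_vertex : finType := (B + {i : I & part i})%type.

Definition graft_edge : rel graft_vertex := fun x y =>
  match x, y with
  | inl a, inl b => edge a b
  | inl a, inr u | inr u, inl a =>
      (a == site (tag u)) && (tagged u == root (part (tag u)))
  | inr u, inr v => (tag u == tag v) && edge (tagged u) (tagged_as u v)
  end.

Lemma graft_edge_sym : symmetric graft_edge.
Proof.
move=> [a|[i x]] [b|[j y]] //=; first exact: edge_sym.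
case: eqVneq => [eq_ij|//]; case: j / eq_ij y => y.
by rewrite !tagged_asE /= edge_sym.
Qed.

Lemma graft_edge_irr : irreflexive graft_edge.
Proof.
by move=> [a|[i x]] /=; rewrite ?tagged_asE ?eqxx /= edge_irr.
Qed.

Definition graft : sgraph := SGraph graft_edge_sym graft_edge_irr.
End Graft.

Definition single : sgraph :=
  @SGraph unit (fun _ _ => false) (fun _ _ => erefl) (fun _ => erefl).

(* A root joined to the roots of disjoint copies of the members of s. *)
Definition join_roots (s : seq rgraph) : rgraph :=
  let site (i : 'I_(size s)) : single := tt in
  let part (i : 'I_(size s)) := nth (@RGraph single tt) s i in
  @RGraph (graft site part) (inl tt).

(* [trees k] is [:: T 0; ...; T k.-1]. *)
Fixpoint trees (k : nat) : seq rgraph :=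
  if k is j.+1 then rcons (trees j) (join_roots (trees j)) else [::].

Definition T (k : nat) : rgraph := join_roots (trees k).

Lemma TE (k : nat) : T k = join_roots [seq T j | j <- iota 0 k].
Proof.
congr join_roots; elim: k => [|k IHk] //=.
by rewrite -[X in _ = X]/[seq T j | j <- iota 0 k.+1] -addn1 iotaD map_cat -IHk cats1.
Qed.

Definition idx (lo n : nat) : Type := {i : 'I_n.+1 | lo <= i}.
HB.instance Definition _ lo n := Finite.on (idx lo n).
Definition nat_of_idx lo n (i : idx lo n) : nat := val (val i).
Coercion nat_of_idx : idx >-> nat.

(* The pairs (i, j) with 4 <= j < i <= n; hence 5 <= i. *)
Definition idx2 (n : nat) : Type :=
  {p : 'I_n.+1 * 'I_n.+1 | 4 <= p.2 < p.1}.
HB.instance Definition _ n := Finite.on (idx2 n).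
Definition fst_idx n (p : idx2 n) : nat := (val p).1.
Definition snd_idx n (p : idx2 n) : nat := (val p).2.

(* All vertices of G_n outside the attached trees; [vM0 i] and [vP0 i] are the
   leaves M_i^(0) and P_i^(0), and [vMa p] is M_ij^(a) for p = (i, j), etc. *)
Inductive core_vertex (n : nat) : Type :=
  | vN of idx 4 n | vR of idx 4 n
  | vM of idx 5 n | vM0 of idx 5 n | vP of idx 5 n | vP0 of idx 5 n
  | vMa of idx2 n | vMb of idx2 n | vMc of idx2 n | vMd of idx2 n
  | vPa of idx2 n | vPb of idx2 n | vPc of idx2 n | vPd of idx2 n
  | vPe of idx2 n | vPf of idx2 n.

Section CoreFinite.
Variable n : nat.

Definition core_code (x : core_vertex n) :
    idx 4 n * 'I_2 + idx 5 n * 'I_4 + idx2 n * 'I_10 :=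
  let c2 i (k : 'I_2) := inl (inl (i, k)) in
  let c4 i (k : 'I_4) := inl (inr (i, k)) in
  let c10 p (k : 'I_10) := inr (p, k) in
  match x with
  | vN i => c2 i (@Ordinal 2 0 isT) | vR i => c2 i (@Ordinal 2 1 isT)
  | vM i => c4 i (@Ordinal 4 0 isT) | vM0 i => c4 i (@Ordinal 4 1 isT)
  | vP i => c4 i (@Ordinal 4 2 isT) | vP0 i => c4 i (@Ordinal 4 3 isT)
  | vMa p => c10 p (@Ordinal 10 0 isT) | vMb p => c10 p (@Ordinal 10 1 isT)
  | vMc p => c10 p (@Ordinal 10 2 isT) | vMd p => c10 p (@Ordinal 10 3 isT)
  | vPa p => c10 p (@Ordinal 10 4 isT) | vPb p => c10 p (@Ordinal 10 5 isT)
  | vPc p => c10 p (@Ordinal 10 6 isT) | vPd p => c10 p (@Ordinal 10 7 isT)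
  | vPe p => c10 p (@Ordinal 10 8 isT) | vPf p => c10 p (@Ordinal 10 9 isT)
  end.

Definition core_decode (c : idx 4 n * 'I_2 + idx 5 n * 'I_4 + idx2 n * 'I_10) :
    core_vertex n :=
  match c with
  | inl (inl (i, k)) => nth (vN i) [:: vN i; vR i] k
  | inl (inr (i, k)) => nth (vM i) [:: vM i; vM0 i; vP i; vP0 i] k
  | inr (p, k) =>
      nth (vMa p) [:: vMa p; vMb p; vMc p; vMd p;
                      vPa p; vPb p; vPc p; vPd p; vPe p; vPf p] k
  end.

Lemma core_codeK : cancel core_code core_decode.
Proof. by case. Qed.

HB.instance Definition _ := Finite.copy (core_vertex n) (can_type core_codeK).
End CoreFinite.

(* Each edge outside the attached trees is listed here in at least one
   direction; [core_edge] is the symmetric closure. *)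
Definition core_arc (n : nat) (x y : core_vertex n) : bool :=
  match x, y with
  | vN i, vN j => i != j
  | vN i, vR j => i == j
  | vN i, vM j => i == j :> nat
  | vN i, vP j => i == j :> nat
  | vM i, vM0 j => i == j
  | vP i, vP0 j => i == j
  | vM i, vMa p => i == fst_idx p :> nat
  | vMa p, vMb q => p == q
  | vMa p, vMc q => p == q
  | vMc p, vMd q => p == q
  | vMd p, vR j => snd_idx p == j :> nat
  | vP i, vPa p => i == fst_idx p :> nat
  | vPa p, vPb q => p == q
  | vPa p, vPc q => p == q
  | vPc p, vPd q => p == q
  | vPc p, vPe q => p == q
  | vPe p, vPf q => p == q
  | vPf p, vR j => snd_idx p == j :> nat
  | _, _ => false
  end.

Definition core_edge (n : nat) : rel (core_vertex n) :=
  fun x y => core_arc x y || core_arc y x.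

Lemma core_edge_sym n : symmetric (@core_edge n).
Proof. by move=> x y; rewrite /core_edge orbC. Qed.

Lemma core_edge_irr n : irreflexive (@core_edge n).
Proof. by case=> // i; rewrite /core_edge /= eqxx. Qed.

Definition core (n : nat) : sgraph := SGraph (@core_edge_sym n) (@core_edge_irr n).

(* An entry (v, k) stands for a fresh T(k) attached to v. *)
Definition attachments (n : nat) : seq (core n * nat) :=
  flatten [seq if i == 4 :> nat then [:: (vN i : core n, 1); (vN i : core n, 2);
                                         (vN i : core n, 3)]
               else [:: (vN i : core n, 3)] | i : idx 4 n] ++
  flatten [seq [:: (vM i : core n, 2); (vP i : core n, 1)] | i : idx 5 n].

Definition Ggraph (n : nat) : sgraph :=
  let entry := tnth (in_tuple (attachments n)) in
  graft (fun i => (entry i).1) (fun i => T (entry i).2).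

Definition Gvertex (n : nat) (x : core_vertex n) : Ggraph n := inl x.

Definition top_idx (n : nat) (hn : 4 <= n) : idx 4 n :=
  exist (fun i : 'I_n.+1 => 4 <= i) ord_max hn.

(* Main.v *)
Require Import Defs.
From mathcomp Require Import all_boot.

(* Leaving R_j by a connecting path never decides the game: the vertices M^(d)
   and P^(f), when entered from R_j, always have value 1. Hence R_j has
   value 0 exactly when N_j has been deleted, and this bit travels along the
   paths: entered from N_k, the vertices M_k and P_k have values 1 and 2 as long
   as no N_j with j < k is deleted, and both have value 3 afterwards. So with S
   the set of deleted N's, N_k has value k when S has no index below k; otherwise
   its value is 1 or 2 according to the parity of the number of remaining N's
   with an index above min S, which drops by one with each move among them. *)

Set Implicit Arguments.
Unset Strict Implicit.
Unset Printing Implicit Defensive.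

(** * Minimal excluded values *)

Lemma mex_notin s : mex s \notin s.
Proof. by rewrite /mex; case: ex_minnP. Qed.

Lemma lt_mex s j : j < mex s -> j \in s.
Proof.
rewrite /mex; case: ex_minnP => m _ min_m; apply: contraTT => /min_m.
by rewrite -leqNgt.
Qed.

Lemma mex_eq s k : k \notin s -> (forall j, j < k -> j \in s) -> mex s = k.
Proof.
move=> k_notin lt_k; case: (ltngtP (mex s) k) => // [/lt_k|/lt_mex].
  by rewrite (negPf (mex_notin s)).
by rewrite (negPf k_notin).
Qed.

Lemma eq_mex s t : s =i t -> mex s = mex t.
Proof.
move=> eq_st; apply: mex_eq => [|j /lt_mex]; rewrite ?eq_st ?mex_notin //.
Qed.

(** * Play inside a fixed vertex type *)

Lemma card_setCU1 (T : finType) (S : {set T}) x :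
  x \notin S -> #|~: S| = #|~: (x |: S)|.+1.
Proof.
move=> xS; rewrite (cardsD1 x) inE xS add1n; congr _.+1; apply: eq_card => y.
by rewrite !inE negb_or.
Qed.

(** Recording the deleted vertices in [S] keeps all positions of a play in one type, where [grundy]
    passes to nested subtypes. *)
Fixpoint walk_rec (G : sgraph) (fuel : nat) (S : {set G}) (x : G) : nat :=
  if fuel is m.+1 then
    mex [seq walk_rec m (x |: S) y | y <- enum G & edge x y && (y \notin x |: S)]
  else 0.

(* The value of (G_S, x), computed inside the fixed vertex type of G. *)
Definition walk (G : sgraph) (S : {set G}) (x : G) : nat := walk_rec #|~: S| S x.

Section Walk.
Variable G : sgraph.
Implicit Types (S : {set G}) (x : G).

Definition walk_option S x v :=
  exists y, [/\ edge x y, y \notin x |: S & walk (x |: S) y = v].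

Lemma walk_mex S x s :
  x \notin S -> (forall v, v \in s <-> walk_option S x v) -> walk S x = mex s.
Proof.
move=> xS opt_s; rewrite /walk (card_setCU1 xS) /=; apply: eq_mex => v.
apply/mapP/idP => [[y]|/opt_s[y [exy yS <-]]].
  rewrite mem_filter => /andP[/andP[exy yS] _] ->; apply/opt_s.
  by exists y.
by exists y; rewrite // mem_filter exy yS mem_enum.
Qed.

Lemma walkE S x : x \notin S ->
  walk S x =
    mex [seq walk (x |: S) y | y <- enum G & edge x y && (y \notin x |: S)].
Proof. by move=> xS; rewrite {1}/walk (card_setCU1 xS). Qed.

Lemma walk_option_mem S x v :
  reflect (walk_option S x v)
    (v \in [seq walk (x |: S) y | y <- enum G & edge x y && (y \notin x |: S)]).
Proof.
apply: (iffP mapP) => [[y]|[y [exy yS <-]]].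
  by rewrite mem_filter => /andP[/andP[exy yS] _] ->; exists y.
by exists y; rewrite // mem_filter exy yS mem_enum.
Qed.

End Walk.

(* Only the part of G that can be reached without entering S matters. *)
Lemma walk_embed (H G : sgraph) (f : H -> G) (S : {set G}) (x : H) :
  injective f -> (forall y z, edge (f y) (f z) = edge y z) ->
  (forall y z, edge (f y) z -> z \in S \/ exists t, z = f t) ->
  f x \notin S -> walk S (f x) = walk (f @^-1: S) x.
Proof.
move=> f_inj f_edge; have [m] := ubnP #|~: S|.
elim: m S x => // m IHm S x leSm S_closed xS.
have xS' : x \notin f @^-1: S by rewrite inE.
have preimU : f @^-1: (f x |: S) = x |: f @^-1: S.
  by apply/setP => y; rewrite !inE (inj_eq f_inj).
have IH y : f y \notin f x |: S ->
    walk (f x |: S) (f y) = walk (x |: f @^-1: S) y.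
  move=> yS; rewrite -preimU; apply: IHm => //.
    by move: leSm; rewrite (card_setCU1 xS).
  by move=> u v /S_closed[vS|]; [left; rewrite inE vS orbT | right].
have memU y : (f y \in f x |: S) = (y \in x |: f @^-1: S).
  by rewrite -preimU [RHS]inE.
(* An edge leaving the image of [f] ends in [S], so it is not a legal move, and the options on both
   sides correspond. *)
rewrite (walkE xS'); apply: walk_mex => // v.
apply: (iff_trans (iff_sym (rwP (walk_option_mem _ _ _)))); split.
  case=> y [exy yS <-]; exists (f y); rewrite f_edge memU IH ?memU //.
case=> z [exz zS <-]; have [zS'|[y def_z]] := S_closed _ _ exz.
  by case/negP: zS; rewrite inE zS' orbT.
by subst z; exists y; rewrite -memU -f_edge IH.
Qed.

Lemma grundy_walk (G : sgraph) (x : G) : grundy (Position G x) = walk set0 x.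
Proof.
have [m] := ubnP #|G|; elim: m G x => // m IHm G x leGm.
rewrite grundyE walkE ?inE //; apply: eq_mex => v.
have cardG : #|del [set x]| < m.
  rewrite card_del1; have /prednK : 0 < #|G| by apply/card_gt0P; exists x.
  by move=> def_G; rewrite -ltnS def_G.
have IH (y : del [set x]) : grundy (Position _ y) = walk (x |: set0) (val y).
  (* The inclusion of the graph without [x] satisfies [walk_embed] for the deleted set [[set x]],
     whose preimage is empty. *)
  pose f (z : del [set x]) : G := val z.
  have valy (z : del [set x]) : val z \notin [set x] by exact: (valP z).
  rewrite IHm // setU0 [RHS](@walk_embed _ _ f) //; last 2 first.
  - exact: val_inj.
  - move=> u w _; case: (boolP (w \in [set x])) => [|wS]; first by left.
    by right; exists (exist _ w wS).
  by congr walk; apply/esym/setP => z; rewrite in_set0 inE (negPf (valy z)).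
rewrite -map_comp; apply/mapP/walk_option_mem.
  case=> y; rewrite mem_filter => /andP[exy _] -> /=; exists (val y).
  by rewrite -IH exy setU0 (valP y).
case=> y [exy]; rewrite setU0 => yS <-.
exists (exist _ y yS); first by rewrite mem_filter exy mem_enum.
by rewrite /= IH setU0.
Qed.

(** * Play on a base graph with rooted parts attached *)

Section GraftWalk.
Variables (B : sgraph) (I : finType) (site : I -> B) (part : I -> Defs.rgraph).
Let G := graft site part.

Lemma inl_inj : injective (inl : B -> G).
Proof. by move=> ? ? []. Qed.

(** Deleted sets of base vertices suffice while the token is in the base: entering a part deletes
    its site, so the token never returns. *)
Definition base_walk (C : {set B}) (x : B) : nat :=
  walk ([set (inl y : G) | y in C]) (inl x : G).

Definition base_option (C : {set B}) (x : B) v :=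
  (exists y, [/\ edge x y, y \notin x |: C & base_walk (x |: C) y = v])
  \/ exists i, site i = x /\ grundy (Position (part i) (Defs.root (part i))) = v.

(** The edge from the site is the only link of a part to the rest; once the site is deleted,
    [walk_embed] applies to the inclusion of the part. *)
Lemma walk_part (C : {set B}) i :
  site i \in C ->
  walk ([set (inl y : G) | y in C])
       (inr (Tagged (fun i => part i) (Defs.root (part i))) : G) =
  grundy (Position (part i) (Defs.root (part i))).
Proof.
move=> iC; pose f (u : part i) : G := inr (Tagged (fun i => part i) u).
rewrite grundy_walk (@walk_embed _ _ f).
- congr walk; apply/setP => u; rewrite !inE; apply/negP => /imsetP[] //.
- by move=> u v [] /eqP; rewrite eq_Tagged => /eqP.
- by move=> u v; rewrite /= eqxx tagged_asE.
- move=> u [y|[j v]] /=.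
    by case/andP => /eqP -> _; left; apply: imset_f.
  by case/andP => /eqP eq_ij; subst j; right; exists v.
- by apply/negP => /imsetP[].
Qed.

Lemma base_optionP (C : {set B}) x v :
  base_option C x v <-> walk_option ([set (inl y : G) | y in C]) (inl x : G) v.
Proof.
have imU : (inl x : G) |: [set (inl y : G) | y in C] =
    [set (inl y : G) | y in x |: C] by rewrite imsetU1.
rewrite /walk_option imU; split.
  case=> [[y [exy yC <-]]|[i [def_x <-]]].
    by exists (inl y); rewrite (mem_imset _ _ inl_inj).
  exists (inr (Tagged (fun i => part i) (Defs.root (part i)))).
  rewrite /= def_x !eqxx; split => //; first by apply/negP => /imsetP[].
  by rewrite walk_part // def_x setU11.
case=> -[y|[i u]] [] /= exy; first by
  rewrite (mem_imset _ _ inl_inj) => yC <-; left; exists y.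
move=> _; case/andP: exy => /eqP def_x /eqP def_u; subst x u => <-.
by right; exists i; rewrite walk_part // setU11.
Qed.

Lemma base_walk_mex (C : {set B}) x s :
  x \notin C -> (forall v, v \in s <-> base_option C x v) ->
  base_walk C x = mex s.
Proof.
move=> xC opt_s; apply: walk_mex; first by rewrite (mem_imset _ _ inl_inj).
by move=> v; apply: iff_trans (opt_s v) (base_optionP _ _ _).
Qed.

Lemma base_walk_neq (C : {set B}) x v :
  x \notin C -> base_option C x v -> base_walk C x != v.
Proof.
move=> xC /base_optionP/walk_option_mem v_in; rewrite /base_walk walkE.
  by apply: contraTneq v_in => <-; apply: mex_notin.
by rewrite (mem_imset _ _ inl_inj).
Qed.

Lemma base_walk_eq (C : {set B}) x k :
  x \notin C -> ~ base_option C x k ->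
  (forall j, j < k -> base_option C x j) -> base_walk C x = k.
Proof.
move=> xC k_notin lt_k; rewrite /base_walk walkE; last first.
  by rewrite (mem_imset _ _ inl_inj).
apply: mex_eq => [|j /lt_k]; last by move/base_optionP/walk_option_mem.
by apply/walk_option_mem => /base_optionP.
Qed.

End GraftWalk.

(** By strong induction the options of the root have exactly the values 0, ..., k-1. *)
Lemma grundy_T k : grundy (Position (T k) (Defs.root (T k))) = k.
Proof.
elim/ltn_ind: k => k IHk; rewrite TE grundy_walk.
set s := [seq T j | j <- iota 0 k].
have size_s : size s = k by rewrite size_map size_iota.
have nth_s j : j < k -> nth (@RGraph single tt) s j = T j.
  by move=> ltjk; rewrite (nth_map 0) ?size_iota // nth_iota.
pose part (i : 'I_(size s)) := nth (@RGraph single tt) s i.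
(* Writing the empty set as an image exposes the goal as a [base_walk]. *)
have <- : [set (inl y : graft (fun _ : 'I_(size s) => (tt : single)) part)
             | y in set0] = set0 by apply: imset0.
apply: (@base_walk_eq single _ _ part); first by rewrite inE.
  case=> [[y []] //|[i [_]]]; rewrite /part.
  have ltik : i < k by rewrite -[X in _ < X]size_s.
  by rewrite nth_s // IHk // => eq_ik; rewrite eq_ik ltnn in ltik.
move=> j ltjk; right.
have ltjs : j < size s by rewrite size_s.
by exists (Ordinal ltjs); rewrite /part nth_s // IHk.
Qed.

(** * Options at the core vertices of G_n *)

Section Gadgets.
Variable n : nat.

(** A tree [T v] attached to [x] contributes just one option, of value [v], so the trees enter the
    later computations only through this predicate. *)
Definition pendant (x : core_vertex n) (v : nat) : bool :=
  match x with
  | vN i => (v == 3) || (i == 4 :> nat) && (0 < v < 3)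
  | vM _ => v == 2
  | vP _ => v == 1
  | _ => false
  end.

Lemma mem_attachments (x : core_vertex n) v :
  ((x, v) \in attachments n) = pendant x v.
Proof.
rewrite /attachments mem_cat; apply/orP/idP.
  case=> /flatten_imageP[i _].
    case: ifP => i4; rewrite !inE.
      by case/or3P => /eqP[-> ->] //=; rewrite i4.
    by move/eqP => [-> ->].
  by rewrite !inE => /orP[] /eqP[-> ->].
case: x => //= i; last 2 first.
- move/eqP => ->; right; apply/flatten_imageP; exists i => //.
  by rewrite !inE eqxx.
- move/eqP => ->; right; apply/flatten_imageP; exists i => //.
  by rewrite !inE eqxx orbT.
move=> vi; left; apply/flatten_imageP; exists i => //.
case: ifP vi => i4 /=; last by rewrite orbF => /eqP ->; rewrite inE.
by case: v => [|[|[|[|v]]]] // _; rewrite !inE !eqxx ?orbT.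
Qed.

Implicit Types (C : {set core n}) (x y : core n).

Definition core_walk C x : nat :=
  let entry := tnth (in_tuple (attachments n)) in
  base_walk (fun i => (entry i).1) (fun i => T (entry i).2) C x.

Definition core_option C x v :=
  (exists y, [/\ edge x y, y \notin x |: C & core_walk (x |: C) y = v])
  \/ pendant x v.

Lemma core_optionE C x v :
  let entry := tnth (in_tuple (attachments n)) in
  base_option (fun i => (entry i).1) (fun i => T (entry i).2) C x v
  <-> core_option C x v.
Proof.
split=> -[opt|]; [by left| |by left|].
  case=> i [def_x <-]; right; rewrite grundy_T -mem_attachments -def_x.
  by rewrite -surjective_pairing (mem_tnth i (in_tuple (attachments n))).
rewrite -mem_attachments => /(tnthP (in_tuple (attachments n)))[i def_i].
by right; exists i; rewrite grundy_T -def_i.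
Qed.

Lemma core_walk_mex C x s :
  x \notin C -> (forall v, v \in s <-> core_option C x v) ->
  core_walk C x = mex s.
Proof.
move=> xC opt_s; apply: base_walk_mex => // v.
exact: iff_trans (opt_s v) (iff_sym (core_optionE _ _ _)).
Qed.

Lemma core_walk_neq C x v :
  x \notin C -> core_option C x v -> core_walk C x != v.
Proof. by move=> xC opt_v; apply: base_walk_neq => //; apply/core_optionE. Qed.

Lemma core_walk_eq C x k :
  x \notin C -> ~ core_option C x k ->
  (forall j, j < k -> core_option C x j) -> core_walk C x = k.
Proof.
move=> xC k_notin lt_k; apply: base_walk_eq => // [/core_optionE //|j /lt_k].
by move/core_optionE.
Qed.

(** The mex of a single value is 1 if that value is 0, and 0 otherwise; the boolean is read as a
    number. A forced move thus negates a bit. *)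
Lemma core_walk_only C x y :
  x \notin C -> edge x y -> y \notin x |: C ->
  (forall z, edge x z -> z \notin x |: C -> z = y) ->
  (forall v, ~~ pendant x v) -> core_walk C x = (core_walk (x |: C) y == 0).
Proof.
move=> xC exy yC only_y no_att.
rewrite (@core_walk_mex _ _ [:: core_walk (x |: C) y]) //.
  case: eqVneq => [->|nz]; first by apply: mex_eq => // -[].
  by apply: mex_eq; rewrite // inE eq_sym.
move=> v; rewrite inE; split=> [/eqP ->|]; first by left; exists y.
case=> [[z [exz zC <-]]|]; last by rewrite (negPf (no_att v)).
by rewrite (only_y z).
Qed.

Lemma core_walk_dead C x :
  x \notin C -> (forall z, edge x z -> z \in x |: C) ->
  (forall v, ~~ pendant x v) -> core_walk C x = 0.
Proof.
move=> xC dead no_att; apply: core_walk_eq => //.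
case=> [[z [exz]]|]; last by rewrite (negPf (no_att _)).
by rewrite (dead z exz).
Qed.

(** The leaf contributes the value 0, and the mex of 0 and a is 2 if a = 1, and 1 otherwise. *)
Lemma core_walk_leaf C x l y :
  x \notin C -> edge x l -> l \notin x |: C -> core_walk (x |: C) l = 0 ->
  edge x y -> y \notin x |: C ->
  (forall z, edge x z -> z \notin x |: C -> z = l \/ z = y) ->
  (forall v, ~~ pendant x v) ->
  core_walk C x = if core_walk (x |: C) y == 1 then 2 else 1.
Proof.
move=> xC exl lC l0 exy yC only no_att.
rewrite (@core_walk_mex _ _ [:: 0; core_walk (x |: C) y]) //.
  case: eqVneq => [->|n1]; first by apply: mex_eq => // -[|[]].
  by apply: mex_eq => [|[]] //; rewrite !inE /= eq_sym.
move=> v; rewrite !inE; split=> [/orP[] /eqP ->|].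
- by left; exists l.
- by left; exists y.
case=> [[z [exz zC <-]]|]; last by rewrite (negPf (no_att v)).
by case: (only z exz zC) => ->; rewrite ?l0 eqxx ?orbT.
Qed.

(** * Leaves, and connecting paths entered from R_j *)

Lemma notin_setU1 C x y : y <> x -> y \notin C -> y \notin x |: C.
Proof. by move=> /eqP neq_yx yC; rewrite !inE negb_or neq_yx. Qed.

(* Holds of every set visited while the token is on some N_i or R_i: the
   connecting paths are either untouched or cut next to R_j. *)
Record clean C : Prop := Clean {
  cleanM0 : forall i, vM0 i \notin C;
  cleanP0 : forall i, vP0 i \notin C;
  cleanMb : forall p, vMb p \notin C;
  cleanPd : forall p, vPd p \notin C;
  cleanMc : forall p, vMd p \notin C -> vMc p \notin C;
  cleanMa : forall p, vMd p \notin C -> vMa p \notin C;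
  cleanPe : forall p, vPf p \notin C -> vPe p \notin C;
  cleanPc : forall p, vPf p \notin C -> vPc p \notin C }.

Ltac solve_notin :=
  repeat (apply: notin_setU1; first by [|case=> ?; subst]); rewrite // ?inE.

(** Runs through the neighbours of a vertex; each should be the expected one or already deleted.
    Undecided cases keep the adjacency equation [E]. *)
Ltac solve_only :=
  let z := fresh "z" in let E := fresh "E" in
  case=> z; rewrite /= /core_edge /= ?orbF => // /eqP E;
  first [by rewrite E | by rewrite !inE -?E ?eqxx ?orbT
        | by rewrite !inE ?E ?eqxx ?orbT | idtac].

Ltac solve_edge := by rewrite /= /core_edge /= eqxx ?orbT.

Lemma idx_inj lo : injective (@nat_of_idx lo n).
Proof. by move=> i j /val_inj/val_inj. Qed.

Lemma core_walk_Mb C p :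
  vMb p \notin C -> vMa p \in C -> core_walk C (vMb p) = 0.
Proof.
move=> bC aC; apply: core_walk_dead => //; solve_only.
by rewrite !inE E aC orbT.
Qed.

Lemma core_walk_Pb C p :
  vPb p \notin C -> vPa p \in C -> core_walk C (vPb p) = 0.
Proof.
move=> bC aC; apply: core_walk_dead => //; solve_only.
by rewrite !inE E aC orbT.
Qed.

Lemma core_walk_Pd C p :
  vPd p \notin C -> vPc p \in C -> core_walk C (vPd p) = 0.
Proof.
move=> bC aC; apply: core_walk_dead => //; solve_only.
by rewrite !inE E aC orbT.
Qed.

Lemma core_walk_M0 C i :
  vM0 i \notin C -> vM i \in C -> core_walk C (vM0 i) = 0.
Proof.
move=> bC aC; apply: core_walk_dead => //; solve_only.
by rewrite !inE E aC orbT.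
Qed.

Lemma core_walk_P0 C i :
  vP0 i \notin C -> vP i \in C -> core_walk C (vP0 i) = 0.
Proof.
move=> bC aC; apply: core_walk_dead => //; solve_only.
by rewrite !inE E aC orbT.
Qed.

(** With R_j gone, the moves to M^(c) and then M^(a) are forced. There the leaf M^(b) is an option
    of value 0, so M^(a) is nonzero, M^(c) has value 0 and M^(d) has value 1, whatever lies
    beyond. *)
Lemma core_walk_Md_from_R C p (j : idx 4 n) :
  clean C -> snd_idx p = j -> vR j \in C -> vMd p \notin C ->
  core_walk C (vMd p) = 1.
Proof.
move=> clC pj jC dC.
have aC := cleanMa clC dC; have bC := cleanMb clC p; have cC := cleanMc clC dC.
rewrite (@core_walk_only _ _ (vMc p)) //; [|solve_edge|solve_notin|solve_only].
  rewrite (@core_walk_only _ _ (vMa p)) //;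
    [|solve_notin|solve_edge|solve_notin|solve_only].
  rewrite (negPf (core_walk_neq _ _)) //; first by solve_notin.
  left; exists (vMb p); split; [solve_edge|by solve_notin|].
  apply: core_walk_Mb; first by solve_notin.
  by rewrite setU11.
(* The neighbour left over by [solve_only] is [vR j], which is deleted. *)
by move: E; rewrite pj => /idx_inj <-; rewrite !inE jC orbT.
Qed.

(** The same argument along P^(f), P^(e), P^(c), with the leaf P^(d) making P^(c) nonzero. *)
Lemma core_walk_Pf_from_R C p (j : idx 4 n) :
  clean C -> snd_idx p = j -> vR j \in C -> vPf p \notin C ->
  core_walk C (vPf p) = 1.
Proof.
move=> clC pj jC fC.
have cC := cleanPc clC fC; have dC := cleanPd clC p; have eC := cleanPe clC fC.
rewrite (@core_walk_only _ _ (vPe p)) //; [|solve_edge|solve_notin|solve_only].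
  rewrite (@core_walk_only _ _ (vPc p)) //;
    [|solve_notin|solve_edge|solve_notin|solve_only].
  rewrite (negPf (core_walk_neq _ _)) //; first by solve_notin.
  left; exists (vPd p); split; [solve_edge|by solve_notin|].
  apply: core_walk_Pd; first by solve_notin.
  by rewrite setU11.
by move: E; rewrite pj => /idx_inj <-; rewrite !inE jC orbT.
Qed.

(** * The value of R_i as a test for the deletion of N_i *)

Lemma in_setU1_neq C x y : y <> x -> (y \in x |: C) = (y \in C).
Proof. by move=> /eqP/negPf neq_yx; rewrite in_setU1 neq_yx. Qed.

Lemma clean_N C i : clean C -> clean (vN i |: C).
Proof. by case=> *; split=> p; rewrite !in_setU1_neq //; auto. Qed.

Lemma clean_R C i : clean C -> clean (vR i |: C).
Proof. by case=> *; split=> p; rewrite !in_setU1_neq //; auto. Qed.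

(** The only moves left lead into connecting paths, and all of these have value 1. *)
Lemma core_walk_R_after_N C i :
  clean C -> vR i \notin C -> vN i \in C -> core_walk C (vR i) = 0.
Proof.
move=> clC RC NC; apply: core_walk_eq => //; case=> [[z []]|//].
have clC' := clean_R i clC.
case: z => z; rewrite /= /core_edge /= ?orbF // => /eqP E.
- by rewrite E !inE NC orbT.
- by move=> zC; rewrite (core_walk_Md_from_R clC' E) ?setU11.
- by move=> zC; rewrite (core_walk_Pf_from_R clC' E) ?setU11.
Qed.

(** Every option is nonzero because it has a reply of value 0: from another N_z the move to R_z,
    from M_i or P_i the move to its leaf. The attached trees have nonzero values as well. *)
Lemma core_walk_N_after_R C i :
  clean C -> (forall j, vR j \notin C) -> vN i \notin C ->
  core_walk (vR i |: C) (vN i) = 0.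
Proof.
move=> clC RC NC; have clC' := clean_N i (clean_R i clC).
apply: core_walk_eq => //; first by solve_notin.
case=> [[z [ez zC]]|/=]; last by case: (_ == 4 :> nat).
apply/eqP; apply: core_walk_neq => //; left.
case: z ez zC => z; rewrite /= /core_edge /= ?orbF // => e_iz.
- have neq_iz : i != z by case/orP: e_iz; rewrite // eq_sym.
  move=> zC; exists (vR z); split; first by solve_edge.
    do 3!apply: notin_setU1 => //.
    by case=> eq_zi; rewrite eq_zi eqxx in neq_iz.
  apply: core_walk_R_after_N; [exact: clean_N| |exact: setU11].
  do 3!apply: notin_setU1 => //.
  by case=> eq_zi; rewrite eq_zi eqxx in neq_iz.
- by rewrite (eqP e_iz) !inE eqxx orbT.
- move=> zC; exists (vM0 z); split; first by solve_edge.
    by apply: notin_setU1 => //; apply: cleanM0.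
  apply: core_walk_M0; last exact: setU11.
  by apply: notin_setU1 => //; apply: cleanM0.
- move=> zC; exists (vP0 z); split; first by solve_edge.
    by apply: notin_setU1 => //; apply: cleanP0.
  apply: core_walk_P0; last exact: setU11.
  by apply: notin_setU1 => //; apply: cleanP0.
Qed.

Lemma core_walk_R_eq0 C i :
  clean C -> (forall j, vR j \notin C) ->
  (core_walk C (vR i) == 0) = (vN i \in C).
Proof.
move=> clC RC; case: (boolP (vN i \in C)) => NC.
  by rewrite core_walk_R_after_N.
apply/negbTE/core_walk_neq => //; left; exists (vN i).
by split; [solve_edge|solve_notin|exact: core_walk_N_after_R].
Qed.

(** * Connecting paths entered from M_i and P_i *)

Lemma clean_M C i : clean C -> clean (vM i |: C).
Proof. by case=> *; split=> p; rewrite !in_setU1_neq //; auto. Qed.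

Lemma clean_P C i : clean C -> clean (vP i |: C).
Proof. by case=> *; split=> p; rewrite !in_setU1_neq //; auto. Qed.

(** A path traversed up to R_j has lost [vMd p], so nothing is required of its inner vertices any
    more. This makes [core_walk_R_eq0] available on arrival at R_j. *)
Lemma clean_Md C p :
  clean C -> clean (vMd p |: (vMc p |: (vMa p |: C))).
Proof.
case=> *; split=> q; try by rewrite !in_setU1_neq //; auto.
all: rewrite in_setU1 negb_or => /andP[/eqP neq_d].
all: rewrite !in_setU1_neq //; try (by auto).
all: by case=> eq_qp; apply: neq_d; rewrite eq_qp.
Qed.

Lemma clean_Pf C p :
  clean C -> clean (vPf p |: (vPe p |: (vPc p |: (vPa p |: C)))).
Proof.
case=> *; split=> q; try by rewrite !in_setU1_neq //; auto.
all: rewrite in_setU1 negb_or => /andP[/eqP neq_f].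
all: rewrite !in_setU1_neq //; try (by auto).
all: by case=> eq_qp; apply: neq_f; rewrite eq_qp.
Qed.

(** R_j is zero exactly when N_j is deleted. Then M^(d), M^(c), M^(a) have values 1, 0, 1; otherwise
    they have values 0, 1, 2. *)
Lemma core_walk_Ma C p (i : idx 5 n) (j : idx 4 n) :
  clean C -> (forall k, vR k \notin C) ->
  fst_idx p = i -> vM i \in C -> snd_idx p = j -> vMd p \notin C ->
  core_walk C (vMa p) = if vN j \in C then 1 else 2.
Proof.
move=> clC RC pi iC pj dC.
have aC := cleanMa clC dC; have bC := cleanMb clC p; have cC := cleanMc clC dC.
have clC' := clean_Md p clC.
rewrite (@core_walk_leaf _ _ (vMb p) (vMc p)) //;
  [|solve_edge|solve_notin| |solve_edge|solve_notin|]; last first.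
- case=> z; rewrite /= /core_edge /= ?orbF // => /eqP E.
  + by move: E; rewrite pi => /idx_inj ->; rewrite !inE iC orbT.
  + by left; rewrite E.
  + by right; rewrite E.
- by apply: core_walk_Mb; [solve_notin | rewrite setU11].
rewrite (@core_walk_only _ _ (vMd p)) //;
  [|solve_notin|solve_edge|solve_notin|solve_only].
rewrite (@core_walk_only _ _ (vR j)) //;
  [|solve_notin| |solve_notin|solve_only].
- rewrite core_walk_R_eq0 //; last by move=> k; solve_notin.
  by rewrite !in_setU1_neq //; case: (_ \in _).
- by rewrite /= /core_edge /= pj eqxx.
- by move=> _; congr vR; apply: idx_inj; rewrite -pj.
Qed.

(** The second vertex with a leaf swaps 1 and 2: P^(f), P^(e), P^(c), P^(a) have values 1, 0, 1, 2
    if N_j is deleted, and 0, 1, 2, 1 otherwise. *)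
Lemma core_walk_Pa C p (i : idx 5 n) (j : idx 4 n) :
  clean C -> (forall k, vR k \notin C) ->
  fst_idx p = i -> vP i \in C -> snd_idx p = j ->
  vPa p \notin C -> vPb p \notin C -> vPf p \notin C ->
  core_walk C (vPa p) = if vN j \in C then 2 else 1.
Proof.
move=> clC RC pi iC pj aC bC fC.
have cC := cleanPc clC fC; have dC := cleanPd clC p; have eC := cleanPe clC fC.
have clC' := clean_Pf p clC.
rewrite (@core_walk_leaf _ _ (vPb p) (vPc p)) //;
  [|solve_edge|solve_notin| |solve_edge|solve_notin|]; last first.
- case=> z; rewrite /= /core_edge /= ?orbF // => /eqP E.
  + by move: E; rewrite pi => /idx_inj ->; rewrite !inE iC orbT.
  + by left; rewrite E.
  + by right; rewrite E.
- by apply: core_walk_Pb; [solve_notin | rewrite setU11].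
rewrite (@core_walk_leaf _ _ (vPd p) (vPe p)) //;
  [|solve_notin|solve_edge|solve_notin| |solve_edge|solve_notin|]; last first.
- case=> z; rewrite /= /core_edge /= ?orbF // => /eqP E.
  + by rewrite E !inE eqxx orbT.
  + by left; rewrite E.
  + by right; rewrite E.
- by apply: core_walk_Pd; [solve_notin | rewrite setU11].
rewrite (@core_walk_only _ _ (vPf p)) //;
  [|solve_notin|solve_edge|solve_notin|solve_only].
rewrite (@core_walk_only _ _ (vR j)) //;
  [|solve_notin| |solve_notin|solve_only].
- rewrite core_walk_R_eq0 //; last by move=> k; solve_notin.
  by rewrite !in_setU1_neq //; case: (_ \in _).
- by rewrite /= /core_edge /= pj eqxx.
- by move=> _; congr vR; apply: idx_inj; rewrite -pj.
Qed.

(** * Positions in which only vertices N_j are deleted *)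

Implicit Types S : {set idx 4 n}.

Definition visitedN S : {set core n} := [set (vN i : core n) | i in S].

(* N_i has lost its value i once some N_j with j < i is deleted. *)
Definition spoilt S (i : nat) : bool :=
  [exists j in S, nat_of_idx j < i].

Lemma mem_visitedN S i : (vN i \in visitedN S) = (i \in S).
Proof. by rewrite mem_imset // => ? ? []. Qed.

Lemma visitedN_U1 S i : vN i |: visitedN S = visitedN (i |: S).
Proof. by rewrite /visitedN imsetU1. Qed.

Lemma notin_visitedN S x :
  (if x is vN _ then False else True) -> x \notin visitedN S.
Proof. by move=> xN; apply/imsetP => -[i _ def_x]; rewrite def_x in xN. Qed.

Lemma clean_visitedN S : clean (visitedN S).
Proof. by split=> *; apply: notin_visitedN. Qed.

Lemma idx2P (p : idx2 n) :
  exists (i : idx 5 n) (j : idx 4 n),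
    [/\ fst_idx p = i, snd_idx p = j & j < i].
Proof.
case: p => -[i j] ij; have /andP[/= le4j ltji] := ij.
have le5i : 4 < i by apply: leq_trans ltji.
by exists (exist _ i le5i), (exist _ j le4j).
Qed.

Lemma idx2_intro (i : idx 5 n) (j : idx 4 n) :
  j < i -> exists p : idx2 n, fst_idx p = i /\ snd_idx p = j.
Proof.
move=> ltji; case: i j ltji => i le5i [j le4j] ltji.
have ij : 4 <= (i, j).2 < (i, j).1 by rewrite /= le4j.
by exists (exist _ (i, j) ij).
Qed.

(** The leaf gives 0 and the tree gives 2. The path to R_j gives 1 if N_j is deleted and another 2
    if not, so the value 1 becomes available exactly when [k] is spoilt. Here [k] is the index [i]
    read in [idx 4 n]. *)
Lemma core_walk_M S (i : idx 5 n) (k : idx 4 n) :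
  k = i :> nat -> k \in S ->
  core_walk (visitedN S) (vM i) = if spoilt S k then 3 else 1.
Proof.
move=> eq_ki kS; have clS := clean_M i (clean_visitedN S).
have RS j : vR j \notin vM i |: visitedN S.
  by apply: notin_setU1 => //; apply: notin_visitedN.
have M0S : core_option (visitedN S) (vM i) 0.
  left; exists (vM0 i); split; first by solve_edge.
    by apply: notin_setU1 => //; apply: notin_visitedN.
  apply: core_walk_M0; last exact: setU11.
  by apply: notin_setU1 => //; apply: notin_visitedN.
have valMa p (j : idx 4 n) : fst_idx p = i -> snd_idx p = j ->
    core_walk (vM i |: visitedN S) (vMa p) = if j \in S then 1 else 2.
  move=> pi pj; rewrite (core_walk_Ma clS RS pi _ pj) ?setU11 //.
    by rewrite in_setU1_neq // mem_visitedN.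
  by apply: notin_setU1 => //; apply: notin_visitedN.
have optE v : core_option (visitedN S) (vM i) v <->
    v = 0 \/ v = 2 \/ v = 1 /\ spoilt S k.
  split=> [|[->|[->|[-> /exists_inP[j jS ltjk]]]]]; last 3 first.
  - exact: M0S.
  - by right.
  - rewrite eq_ki in ltjk; have [p [pi pj]] := idx2_intro ltjk.
    left; exists (vMa p); split; last by rewrite (valMa p j) ?jS.
      by rewrite /= /core_edge /= pi eqxx.
    by apply: notin_setU1 => //; apply: notin_visitedN.
  case=> [[z []]|/eqP ->]; last by right; left.
  case: z => z; rewrite /= /core_edge /= ?orbF // => /eqP E.
  + rewrite in_setU1_neq // mem_visitedN (_ : z = k) ?kS //.
    by apply: idx_inj; rewrite eq_ki.
  + move=> zS <-; left; apply: core_walk_M0; last by rewrite E setU11.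
    by apply: notin_setU1 => //; apply: notin_visitedN.
  + have [i' [j [pi' pj ltji]]] := idx2P z.
    rewrite (valMa z j) // => _ <-; right.
    case: ifP => jS; [right; split=> // | by left].
    by apply/exists_inP; exists j; rewrite // eq_ki E pi'.
have iS : vM i \notin visitedN S by apply: notin_visitedN.
case: ifP => spS; apply: core_walk_eq => // [/optE|j lt_j].
- by case=> // -[//|[]].
- by apply/optE; case: j lt_j => [|[|[|]]] //; auto.
- by rewrite spS; case=> // -[//|[]].
- by apply/optE; case: j lt_j => [|[|[|]]] //; auto.
Qed.

(** As for M_i with 1 and 2 exchanged: leaf and tree give 0 and 1, and a path gives 2 exactly when
    its N_j is deleted. *)
Lemma core_walk_P S (i : idx 5 n) (k : idx 4 n) :
  k = i :> nat -> k \in S ->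
  core_walk (visitedN S) (vP i) = if spoilt S k then 3 else 2.
Proof.
move=> eq_ki kS; have clS := clean_P i (clean_visitedN S).
have RS j : vR j \notin vP i |: visitedN S.
  by apply: notin_setU1 => //; apply: notin_visitedN.
have P0S : core_option (visitedN S) (vP i) 0.
  left; exists (vP0 i); split; first by solve_edge.
    by apply: notin_setU1 => //; apply: notin_visitedN.
  apply: core_walk_P0; last exact: setU11.
  by apply: notin_setU1 => //; apply: notin_visitedN.
have valPa p (j : idx 4 n) : fst_idx p = i -> snd_idx p = j ->
    core_walk (vP i |: visitedN S) (vPa p) = if j \in S then 2 else 1.
  move=> pi pj; rewrite (core_walk_Pa clS RS pi _ pj) ?setU11 //.
  - by rewrite in_setU1_neq // mem_visitedN.
  - by apply: notin_setU1 => //; apply: notin_visitedN.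
  - by apply: notin_setU1 => //; apply: notin_visitedN.
  - by apply: notin_setU1 => //; apply: notin_visitedN.
have optE v : core_option (visitedN S) (vP i) v <->
    v = 0 \/ v = 1 \/ v = 2 /\ spoilt S k.
  split=> [|[->|[->|[-> /exists_inP[j jS ltjk]]]]]; last 3 first.
  - exact: P0S.
  - by right.
  - rewrite eq_ki in ltjk; have [p [pi pj]] := idx2_intro ltjk.
    left; exists (vPa p); split; last by rewrite (valPa p j) ?jS.
      by rewrite /= /core_edge /= pi eqxx.
    by apply: notin_setU1 => //; apply: notin_visitedN.
  case=> [[z []]|/eqP ->]; last by right; left.
  case: z => z; rewrite /= /core_edge /= ?orbF // => /eqP E.
  + rewrite in_setU1_neq // mem_visitedN (_ : z = k) ?kS //.
    by apply: idx_inj; rewrite eq_ki.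
  + move=> zS <-; left; apply: core_walk_P0; last by rewrite E setU11.
    by apply: notin_setU1 => //; apply: notin_visitedN.
  + have [i' [j [pi' pj ltji]]] := idx2P z.
    rewrite (valPa z j) // => _ <-; right.
    case: ifP => jS; [right; split=> // | by left].
    by apply/exists_inP; exists j; rewrite // eq_ki E pi'.
have iS : vP i \notin visitedN S by apply: notin_visitedN.
case: ifP => spS; apply: core_walk_eq => // [/optE|j lt_j].
- by case=> // -[//|[]].
- by apply/optE; case: j lt_j => [|[|[|]]] //; auto.
- by rewrite spS; case=> // -[//|[]].
- by apply/optE; case: j lt_j => [|[|[|]]] //; auto.
Qed.

(** * The clique of the vertices N_k *)

Lemma spoiltU1 S (k : idx 4 n) i : spoilt (k |: S) i = spoilt S i || (k < i).
Proof.
apply/exists_inP/orP => [[j /setU1P[->|jS] ltji]|[/exists_inP[j jS ltji]|ltki]].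
- by right.
- by left; apply/exists_inP; exists j.
- by exists j; rewrite // setU1r.
- by exists k; rewrite ?setU11.
Qed.

(** R_k gives 0 and the attached [T 3] gives 3. M_k and P_k give 1 and 2 if [k] is not spoilt, and
    only repeat 3 otherwise. *)
Lemma core_option_N S (k : idx 4 n) v : k \notin S ->
  core_option (visitedN S) (vN k) v <->
  [\/ v = 0, v = 3, ~~ spoilt S k /\ 0 < v < 3 |
     exists2 j, j \notin k |: S & core_walk (visitedN (k |: S)) (vN j) = v].
Proof.
move=> kS.
have spk : spoilt (k |: S) k = spoilt S k by rewrite spoiltU1 ltnn orbF.
have val_M (i : idx 5 n) : k = i :> nat ->
    core_walk (visitedN (k |: S)) (vM i) = if spoilt S k then 3 else 1.
  by move=> eq_ki; rewrite (core_walk_M eq_ki) ?setU11 // spk.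
have val_P (i : idx 5 n) : k = i :> nat ->
    core_walk (visitedN (k |: S)) (vP i) = if spoilt S k then 3 else 2.
  by move=> eq_ki; rewrite (core_walk_P eq_ki) ?setU11 // spk.
have val_R : core_walk (visitedN (k |: S)) (vR k) = 0.
  apply: core_walk_R_after_N; first exact: clean_visitedN.
    exact: notin_visitedN.
  by rewrite mem_visitedN setU11.
rewrite /core_option visitedN_U1; split.
  case=> [[z []]|/= /orP[/eqP ->|/andP[/eqP k4 v_lt3]]].
  - case: z => z; rewrite /= /core_edge /= ?orbF // => ekz.
    + by rewrite mem_visitedN => zS <-; apply: Or44; exists z.
    + by rewrite -(eqP ekz) val_R => _ <-; apply: Or41.
    + move=> _ <-; rewrite val_M; last exact/eqP.
      by case: ifP => spS; [apply: Or42 | apply: Or43].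
    + move=> _ <-; rewrite val_P; last exact/eqP.
      by case: ifP => spS; [apply: Or42 | apply: Or43].
  - exact: Or42.
  (* The index 4 is the least one, so it is never spoilt. *)
  - apply: Or43; split=> //; apply/exists_inP => -[j _].
    by rewrite k4 ltnNge (valP j).
case=> [->|->|[spS v_lt3]|[j jS <-]].
- left; exists (vR k); split; [by rewrite /= /core_edge /= eqxx| |exact: val_R].
  exact: notin_visitedN.
- by right.
(* N_4 has the values 1 and 2 from its trees; for larger indices they come from M_k and P_k. *)
- have [k4|k_neq4] := eqVneq (k : nat) 4.
    by right; rewrite /= k4 eqxx v_lt3 orbT.
  have le5k : 4 < val k by rewrite ltn_neqAle eq_sym k_neq4 (valP k).
  pose i : idx 5 n := exist _ (val k) le5k.
  have eq_ki : k = i :> nat by [].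
  left; case: v v_lt3 => [|[|[|v]]] // _.
    exists (vM i); split; [by rewrite /= /core_edge /= eqxx| |].
      exact: notin_visitedN.
    by rewrite val_M // (negPf spS).
  exists (vP i); split; [by rewrite /= /core_edge /= eqxx| |].
    exact: notin_visitedN.
  by rewrite val_P // (negPf spS).
- left; exists (vN j); rewrite mem_visitedN; split=> //.
  rewrite /= /core_edge /=; apply/orP; left; apply: contraNneq jS => <-.
  exact: setU11.
Qed.

Definition spoilt_set S : {set idx 4 n} :=
  [set j | (j \notin S) && spoilt S (nat_of_idx j)].

Lemma core_walk_N S (k : idx 4 n) : k \notin S ->
  core_walk (visitedN S) (vN k) =
    if spoilt S k then if odd #|spoilt_set S| then 1 else 2 else k.
Proof.
have [m] := ubnP #|~: S|; elim: m S k => // m IHm S k leSm kS.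
have IH (j : idx 4 n) : j \notin k |: S -> core_walk (visitedN (k |: S)) (vN j) =
    if spoilt (k |: S) j then if odd #|spoilt_set (k |: S)| then 1 else 2 else j.
  by apply: IHm; move: leSm; rewrite (card_setCU1 kS).
have kN : vN k \notin visitedN S by rewrite mem_visitedN.
have ge4 (j : idx 4 n) : 4 <= j := valP j.
case: ifP => spS.
  have spU (j : idx 4 n) : spoilt (k |: S) j = spoilt S j.
    (* An index below [k] is already deleted, so deleting N_k spoils nothing new. *)
    rewrite spoiltU1; apply/orb_idr => ltkj.
    have /exists_inP[i iS ltik] := spS.
    by apply/exists_inP; exists i; rewrite // (ltn_trans ltik).
  have setU : spoilt_set (k |: S) = spoilt_set S :\ k.
    by apply/setP => j; rewrite !inE spU negb_or andbA.
  have cardS : #|spoilt_set S| = #|spoilt_set (k |: S)|.+1.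
    by rewrite setU (cardsD1 k) inE kS spS.
  (* After the move the parity has changed, so spoilt vertices take the other of the values 1 and 2,
     while unspoilt ones keep their index, at least 4. *)
  rewrite cardS; apply: core_walk_eq => // [/(core_option_N _ kS)|j ltj].
    case; [by case: odd|by case: odd|by rewrite spS; case|].
    case=> j jU; rewrite IH // spU /=; case: ifP => _; first by case: odd.
    by have := ge4 j; case: odd => /= [le4j|le4j] eq_j; rewrite eq_j in le4j.
  apply/(core_option_N _ kS).
  case: j ltj => [|[|j]]; [by move=> _; apply: Or41| |by case: odd].
  rewrite /=; case: ifP => // odd_S _; apply: Or44.
  (* An odd count after the move leaves a spoilt N_j to move to, and its value is then 1. *)
  have /card_gt0P[j] : 0 < #|spoilt_set (k |: S)|.
    by move: odd_S; case: #|_|.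
  rewrite inE => /andP[jU spj]; exists j => //.
  by rewrite IH // spj; case: odd odd_S.
apply: core_walk_eq => // [/(core_option_N _ kS)|v ltv].
  case=> [k0|k3|[_ /andP[_ lt3]]|[j jU]].
  - by have := ge4 k; rewrite k0.
  - by have := ge4 k; rewrite k3.
  - by have := ge4 k; rewrite leqNgt (leq_trans lt3).
  rewrite IH //; case: ifP => _; last first.
    by move/idx_inj => eq_jk; rewrite eq_jk setU11 in jU.
  by have := ge4 k; case: odd => le4k eq_k; rewrite -eq_k in le4k.
apply/(core_option_N _ kS); have [lt4|le4v] := ltnP v 4.
  case: v lt4 {ltv} => [|[|[|[|v]]]] // _.
  - exact: Or41.
  - by apply: Or43; rewrite spS.
  - by apply: Or43; rewrite spS.
  - exact: Or42.
(* A value v with 4 <= v < k is reached at N_v: it is still present, since its deletion would have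
   spoilt [k], and deleting N_k does not spoil the smaller index v. *)
have ltvn : v < n.+1 by apply: ltn_trans ltv (ltn_ord (val k)).
pose j : idx 4 n := exist _ (Ordinal ltvn) le4v.
have jU : j \notin k |: S.
  rewrite !inE negb_or; apply/andP; split.
    by apply: contraTneq ltv => <-; rewrite ltnn.
  apply: contraFN spS => jS; apply/exists_inP; by exists j.
apply: Or44; exists j => //; rewrite IH // spoiltU1 ifF //.
apply/negbTE; rewrite negb_or -leqNgt (ltnW ltv) andbT.
apply: contraFN spS => /exists_inP[i iS ltij]; apply/exists_inP; exists i => //.
exact: ltn_trans ltij ltv.
Qed.

End Gadgets.

Theorem mainTheorem10 (n : nat) (hn : 4 <= n) :
  grundy (Position (Ggraph n) (Gvertex (vN (top_idx hn)))) = n.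
Proof.
have notS : top_idx hn \notin set0 by rewrite inE.
(* At the start nothing is deleted, so the top index is not spoilt. *)
have := core_walk_N notS; rewrite /visitedN imset0 ifF; last first.
  by apply/exists_inP => -[j]; rewrite inE.
by rewrite /core_walk /base_walk imset0 -grundy_walk.
Qed.
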